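(* Let $q>2$ be a prime power. Then the atoms of the lattice of monomial clones on $\mathbb{F}_q$ are given by $\langle\{x_1x_2^{q-1}\}\rangle$ and the monomial clones $\langle\{x_1^{s}\}\rangle$ where $2\le s\le q-1$ and ($s^P\equiv 1 \pmod{q-1}$ for some prime $P$, or $s\cdot s\equiv s\pmod{q-1}$).
   Context: $\mathbb{N}=\{1,2,\dots\}$, $\mathbb{N}_0=\mathbb{N}\cup\{0\}$, $\mathbb{F}_q$ is the field with $q$ elements. A monomial is a formal product $g=\prod_{i\in\mathbb{N}}x_i^{\alpha(i)}$ with $\alpha(i)\in\mathbb{N}_0$, finitely many but at least one $\alpha(i)$ nonzero (so $1$ is not a monomial); $\mathrm{mI}(g)$ is the largest $i$ with $\alpha(i)\neq0$, called the arity of $g$. For $n\ge\mathrm{mI}(g)$ the $n$-ary induced function is $g^{\mathbb{F}_q^n}\colon\mathbb{F}_q^n\to\mathbb{F}_q$, $(x_1,\dots,x_n)\mapsto\prod_{i=1}^nx_i^{\alpha(i)}$. Monomials $m_1,m_2$ are equivalent if the $\mathrm{mI}(m_1)$-ary induced function of $m_1$ equals the $\mathrm{mI}(m_2)$-ary induced function of $m_2$ (i.e. for each $i$ the exponents of $x_i$ in $m_1$ and $m_2$ are equal, or both positive and congruent modulo $q-1$). A clone on a set $A$ is a set of finitary operations on $A$ (of arities $\ge1$) containing all projections and closed under composition. A set $M$ of monomials is a monomial clone on $\mathbb{F}_q$ if $\{m^{\mathbb{F}_q^n}\mid m\in M,\ n\ge\mathrm{mI}(m)\}$ is a clone on $\mathbb{F}_q$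 and $M$ is closed under equivalent monomials. For a set $M'$ of monomials, $\langle M'\rangle$ is the least monomial clone on $\mathbb{F}_q$ containing $M'$. The set of all monomial clones on $\mathbb{F}_q$, ordered by inclusion, is a lattice with least element $\Delta=\langle\{x_1\}\rangle$ and largest element $\nabla=\langle\{x_1x_2\}\rangle$. An atom is a monomial clone $C$ with $C\neq\Delta$ and $C\neq\nabla$ such that every monomial clone $D\subseteq C$ satisfies $D=\Delta$ or $D=C$. *)

(* Defs.v *)
From HB Require Import structures.
From mathcomp Require Import all_boot all_algebra finmap.
From mathcomp Require Import boolp classical_sets.
From mathcomp.multinomials Require Import monalg.

Set Implicit Arguments.
Unset Strict Implicit.
Unset Printing Implicit Defensive.

Local Open Scope classical_set_scope.

Definition op (A : finType) (n : nat) : finType :=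
  {ffun {ffun 'I_n -> A} -> A}.

Definition operation (A : finType) := {n : nat & op A n}.

Definition mkop (A : finType) (n : nat) (f : op A n) : operation A :=
  Tagged (op A) f.

Definition proj (A : finType) (n : nat) (i : 'I_n) : op A n :=
  [ffun x : {ffun 'I_n -> A} => x i].

Definition comp (A : finType) (m n : nat) (f : op A n) (g : 'I_n -> op A m) :
  op A m := [ffun x : {ffun 'I_m -> A} => f [ffun i => g i x]].

Definition is_clone (A : finType) (C : set (operation A)) : Prop :=
  [/\ forall (n : nat) (f : op A n), C (mkop f) -> 0 < n,
      forall (n : nat) (i : 'I_n), C (mkop (proj A i))
    & forall (m n : nat) (f : op A n) (g : 'I_n -> op A m),
        C (mkop f) -> (forall i, C (mkop (g i))) -> C (mkop (comp f g))].

(* Variables are numbered from 0: [ucm i] is the variable x_(i+1), and [m i] is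
   the exponent of x_(i+1) in [m].  The type {cmonom nat} contains the empty
   product [mone], which is not a monomial here. *)
Definition is_monomial (m : {cmonom nat}) : bool := m != mone.

(* The shift i.+1 makes this the largest index in the 1-based numbering. *)
Definition mI (m : {cmonom nat}) : nat := \max_(i <- finsupp m) i.+1.

(* Meaningful for mI m <= n only.  As 0 ^+ 0 = 1, variables with exponent 0
   are ignored, also at the argument 0. *)
Definition induced (F : finFieldType) (m : {cmonom nat}) (n : nat) : op F n :=
  [ffun x : {ffun 'I_n -> F} => (\prod_(i < n) x i ^+ m i)%R].

(* Equality in the type of operations, so the two arities must agree. *)
Definition equivalent (F : finFieldType) (m1 m2 : {cmonom nat}) : Prop :=
  mkop (induced F m1 (mI m1)) = mkop (induced F m2 (mI m2)).

Definition induced_ops (F : finFieldType) (M : set {cmonom nat}) :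
    set (operation F) :=
  [set f | exists m n, [/\ M m, mI m <= n & f = mkop (induced F m n)]].
Arguments induced_ops F M : clear implicits.

Definition monomial_clone (F : finFieldType) (M : set {cmonom nat}) : Prop :=
  [/\ forall m, M m -> is_monomial m,
      is_clone (induced_ops F M)
    & forall m1 m2, is_monomial m2 -> equivalent F m1 m2 -> M m1 -> M m2].

Definition generated (F : finFieldType) (M : set {cmonom nat}) :
    set {cmonom nat} :=
  smallest (monomial_clone F) M.

Definition Delta (F : finFieldType) : set {cmonom nat} :=
  generated F [set ucm 0].

Definition Nabla (F : finFieldType) : set {cmonom nat} :=
  generated F [set mmul (ucm 0) (ucm 1)].

Definition atom (F : finFieldType) (C : set {cmonom nat}) : Prop :=
  [/\ monomial_clone F C, C <> Delta F, C <> Nabla F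
    & forall D, monomial_clone F D -> D `<=` C -> D = Delta F \/ D = C].

(* Main.v *)
Require Import Defs.
From HB Require Import structures.
From mathcomp Require Import all_boot all_algebra finmap.
From mathcomp Require Import cyclic finfield.
From mathcomp Require Import boolp classical_sets.
From mathcomp.multinomials Require Import monalg.

Import GRing.Theory.

Set Implicit Arguments.
Unset Strict Implicit.
Unset Printing Implicit Defensive.

Local Open Scope classical_set_scope.

(** Put N = q - 1.  An induced function determines the exponents of its
    monomial up to the relation in which 0 is equivalent only to itself and two
    positive exponents are equivalent when they are congruent modulo N: the
    argument 0 detects which variables occur, and a primitive root of the field
    detects residues modulo N ([induced_eqP]).  So a monomial clone is a set of
    monomials that contains the variables, is closed under substitution and is
    saturated for this relation ([monomial_cloneP]); from there on the field
    is no longer involved.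

    Two such sets bound the clones of interest from above: [power_clone N s],
    the monomials equivalent to some x_i ^ (s ^ k), contains the clone of
    x_1 ^ s, and for s = 1 it is the least clone; [idempotent_clone N], the
    monomials of degree 1 modulo N, contains the clone of x_1 x_2 ^ N.

    The key fact is [closed_dichotomy]: a clone with a nontrivial member m
    contains either some x_1 ^ t with t not congruent to 1, or x_1 x_2 ^ N.
    Indeed, identifying all variables of m gives x_1 ^ (deg m).  If all degrees
    are 1 modulo N, then m involves at least two variables, and identifying all
    but one of them gives x ^ a y ^ b with a, b > 0 and a + b = 1 modulo N.
    Iterated substitution into x replaces a by its powers, hence by an
    idempotent e, and b by c = 1 - e; then f = x ^ e y ^ c satisfies
    f (x, f (y, x)) = x ^ (e + c ^ 2) y ^ (e c), which is equivalent to x y ^ N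
    since e and c = 1 - e are orthogonal idempotents modulo N
    ([closed_absorption]).

    What remains is about the multiplicative monoid of residues modulo N: every
    t other than 1 has a power s other than 1 that is idempotent or of prime
    order ([exists_minimal_power]), and every power of such an s other than 1
    generates s in turn ([power_generates]).  Hence every nontrivial clone
    contains one of the listed clones, and a nontrivial clone inside a listed
    one contains its generator; the degree tells x_1 x_2 ^ N apart from proper
    powers of a variable. *)

(** * Powers of residues modulo N *)

Lemma congr_modnD (N a b c d : nat) :
  a = b %[mod N] -> c = d %[mod N] -> a + c = b + d %[mod N].
Proof. by move=> e f; rewrite -modnDm e f modnDm. Qed.

Lemma congr_modnM (N a b c d : nat) :
  a = b %[mod N] -> c = d %[mod N] -> a * c = b * d %[mod N].
Proof. by move=> e f; rewrite -modnMm e f modnMm. Qed.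

Lemma congr_modnX (N k a b : nat) : a = b %[mod N] -> a ^ k = b ^ k %[mod N].
Proof. by move=> e; rewrite -modnXm e modnXm. Qed.

(** Finiteness makes the powers of t eventually periodic; an exponent that is a
    multiple of the period and lies beyond the preperiod yields an
    idempotent. *)
Lemma exists_idempotent_power (N t : nat) : 0 < N ->
  exists2 l, 0 < l & t ^ l * t ^ l = t ^ l %[mod N].
Proof.
move=> N0.
have [i [d d0 tid]] : exists i, exists2 d, 0 < d & t ^ (i + d) = t ^ i %[mod N].
  pose f (i : 'I_N.+1) : 'I_N := Ordinal (ltn_pmod (t ^ i) N0).
  have /injectivePn [i [j neqij fij]] : ~~ injectiveb f.
    apply/negP => /injectiveP /leq_card.
    by rewrite !card_ord ltnn.
  have {}fij : t ^ i = t ^ j %[mod N] by case: fij.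
  wlog ltij : i j neqij fij / i < j.
    move=> H; case: (ltngtP i j) => [|ji|/val_inj e]; first exact: (H i j).
      by apply: (H j i) => //; rewrite eq_sym.
    by rewrite e eqxx in neqij.
  exists i, (j - i); first by rewrite subn_gt0.
  by rewrite subnKC 1?ltnW.
have per k c : t ^ (i + c + k * d) = t ^ (i + c) %[mod N].
  elim: k => [|k IH]; first by rewrite addn0.
  have -> : i + c + k.+1 * d = (i + d) + (c + k * d).
    by rewrite mulSn !addnA; congr (_ + _); rewrite addnAC.
  by rewrite expnD (congr_modnM tid erefl) -expnD addnA.
(* a positive multiple of the period d that is at least the preperiod i *)
exists (i.+1 * d); first by rewrite muln_gt0.
have le_i : i <= i.+1 * d by rewrite (leq_trans (leqnSn i)) ?leq_pmulr.
by rewrite -expnD -{1 3}(subnKC le_i) per.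
Qed.

(** Take an idempotent power of t.  If it is 1, then t is invertible of some
    order d > 1, and raising t to d divided by a prime factor P of d leaves an
    element of order P. *)
Lemma exists_minimal_power (N t : nat) : 0 < N -> t <> 1 %[mod N] ->
  exists l, t ^ l <> 1 %[mod N] /\
    ((exists P, prime P /\ (t ^ l) ^ P = 1 %[mod N]) \/
     t ^ l * t ^ l = t ^ l %[mod N]).
Proof.
move=> N0 t1; have [l l0 idl] := exists_idempotent_power t N0.
have [el|/eqP nel] := eqVneq (t ^ l %% N) (1 %% N); last by exists l; auto.
have ex : exists d, (0 < d) && (t ^ d == 1 %[mod N]).
  by exists l; rewrite l0 el eqxx.
case: (ex_minnP ex) => d /andP[d0 /eqP td] dmin.
have d1 : 1 < d.
  by rewrite ltn_neqAle d0 andbT; apply/eqP => d1; rewrite -d1 expn1 in td.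
have pr := pdiv_prime d1; have dv := pdiv_dvd d.
exists (d %/ pdiv d); split; last first.
  by left; exists (pdiv d); split; rewrite // -expnM divnK.
move=> e; have := dmin (d %/ pdiv d).
rewrite e eqxx andbT divn_gt0 ?prime_gt0 // dvdn_leq //= => /(_ isT).
by rewrite leqNgt ltn_Pdiv ?prime_gt1.
Qed.

(** Exponents have to stay positive, so the residue 0 is represented by N. *)
Lemma exists_positive_residue (N a : nat) : 0 < N ->
  exists2 r, 0 < r <= N & r = a %[mod N].
Proof.
move=> N0; case: (posnP (a %% N)) => [e|r0].
  by exists N; rewrite ?N0 ?leqnn ?modnn.
by exists (a %% N); rewrite ?modn_mod // r0 ltnW ?ltn_pmod.
Qed.

(** If s has prime order P, a power s ^ k other than 1 has k prime to P, and a
    Bezout relation inverts k; if s is idempotent, s ^ k is s itself. *)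
Lemma power_generates (N s k : nat) : s ^ k <> 1 %[mod N] ->
  (exists P, prime P /\ s ^ P = 1 %[mod N]) \/ s * s = s %[mod N] ->
  exists l, (s ^ k) ^ l = s %[mod N].
Proof.
move=> sk [[P [pP sP]]|idem].
  have k0 : 0 < k by case: k sk => [[]|].
  have cop : coprime k P.
    rewrite coprime_sym prime_coprime //; apply/negP => /dvdnP[c ek].
    by apply: sk; rewrite ek mulnC expnM (congr_modnX _ sP) exp1n.
  case: (egcdnP P k0) => u v e _; exists u.
  rewrite -expnM mulnC e (eqP cop) expnD expn1 (mulnC v) expnM.
  rewrite (congr_modnM (congr_modnX v sP) (erefl (s %% N))).
  by rewrite exp1n mul1n.
exists 1; rewrite expn1; case: k sk => [[]//|k _].
elim: k => [|k IH]; first by rewrite expn1.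
by rewrite expnS (congr_modnM erefl IH).
Qed.

(** * Monomials, substitution and equivalent exponents *)

Lemma cm_ext (m1 m2 : {cmonom nat}) : (forall i, m1 i = m2 i) -> m1 = m2.
Proof. by move=> e; apply/eqP/cmP. Qed.

Lemma expcmnE (m : {cmonom nat}) (n i : nat) : expcmn m n i = n * m i.
Proof.
case: n => [|n]; first by rewrite /expcmn /= onecmE.
rewrite /expcmn iteropS; elim: n => [|n IH]; first by rewrite mul1n.
by rewrite iterS mulcmE IH mulSn.
Qed.

Lemma mmulE (m1 m2 : {cmonom nat}) (i : nat) : mmul m1 m2 i = m1 i + m2 i.
Proof. exact: cmM. Qed.

Lemma expcmn1 (m : {cmonom nat}) : expcmn m 1 = m.
Proof. by apply: cm_ext => i; rewrite expcmnE mul1n. Qed.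

Lemma expcmn_mul (m : {cmonom nat}) (a b : nat) :
  expcmn (expcmn m a) b = expcmn m (a * b).
Proof. by apply: cm_ext => i; rewrite !expcmnE mulnA (mulnC b). Qed.

Lemma mdeg_expcmn (m : {cmonom nat}) (n : nat) : mdeg (expcmn m n) = n * mdeg m.
Proof.
case: n => [|n]; first by rewrite mdeg1.
rewrite /expcmn iteropS; elim: n => [|n IH]; first by rewrite mul1n.
by rewrite iterS mdegM IH mulSn.
Qed.

Lemma is_monomialP (m : {cmonom nat}) :
  reflect (exists i, m i != 0) (is_monomial m).
Proof.
apply: (iffP idP) => [nm|[i mi]].
  have : finsupp m != fset0.
    apply: contra nm => /eqP e; apply/eqP/cm_ext => i.
    by rewrite cm1; apply/eqP; rewrite cmE_eq0 e inE.
  by case/fset0Pn => i; rewrite -cmE_neq0; exists i.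
by apply: contra mi => /eqP->; rewrite cm1.
Qed.

Lemma mI_leP (m : {cmonom nat}) (n : nat) :
  reflect (forall i, n <= i -> m i = 0) (mI m <= n).
Proof.
apply: (iffP (@bigmax_leqP_seq _ _ _ _ _)) => [le i ni|z i].
  by apply/eqP; rewrite cmE_eq0; apply: contraL ni => /le; rewrite -ltnNge;
    apply.
by rewrite -cmE_neq0 => mi _; rewrite ltnNge; apply: contra mi => /z ->.
Qed.

Definition substm (n : nat) (m : {cmonom nat}) (g : 'I_n -> {cmonom nat}) :
  {cmonom nat} := \big[mmul/mone]_(i < n) expcmn (g i) (m i).

Lemma substmE (n : nat) (m : {cmonom nat}) (g : 'I_n -> {cmonom nat})
    (j : nat) :
  substm m g j = \sum_(i < n) m i * g i j.
Proof.
rewrite /substm.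
rewrite (big_morph (fun m : {cmonom nat} => m j) (id1 := 0) (op1 := addn)).
- by apply: eq_bigr => i _; rewrite expcmnE.
- by move=> x y; rewrite mmulE.
- by rewrite cm1.
Qed.

Lemma mdeg_substm (n : nat) (m : {cmonom nat}) (g : 'I_n -> {cmonom nat}) :
  mdeg (substm m g) = \sum_(i < n) m i * mdeg (g i).
Proof. by rewrite mdeg_prod; apply: eq_bigr => i _; rewrite mdeg_expcmn. Qed.

Lemma substm_ucm (n : nat) (m : {cmonom nat}) : mI m <= n ->
  substm m (fun i : 'I_n => ucm (i : nat)) = m.
Proof.
move=> /mI_leP mn; apply: cm_ext => j; rewrite substmE.
under eq_bigr do rewrite ucmE.
have [jn|nj] := ltnP j n; last first.
  rewrite mn // big1 // => i _; case: eqP => [e|_]; last by rewrite muln0.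
  by have := ltn_ord i; rewrite ltnNge e nj.
rewrite (bigD1 (Ordinal jn)) //= eqxx muln1 big1 ?addn0 // => i ne.
by case: eqP => [e|_]; [case/eqP: ne; apply: val_inj | rewrite muln0].
Qed.

(** The degree as a sum over an initial segment of the variables, which is the
    shape in which substitutions are indexed. *)
Lemma mdeg_sum (n : nat) (m : {cmonom nat}) : mI m <= n ->
  mdeg m = \sum_(i < n) m i.
Proof.
move=> mn; rewrite -{1}(substm_ucm mn) mdeg_substm.
by apply: eq_bigr => i _; rewrite mdegU muln1.
Qed.

(** The relation that [equivalent] amounts to over the field with N + 1
    elements.  Positivity is recorded separately since x ^ 0 and x ^ N differ
    at 0. *)
Definition congr_exponents (N : nat) (m1 m2 : {cmonom nat}) : Prop :=
  forall i, (m1 i == 0) = (m2 i == 0) /\ m1 i = m2 i %[mod N].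

Lemma congr_exponents_sym (N : nat) (m1 m2 : {cmonom nat}) :
  congr_exponents N m1 m2 -> congr_exponents N m2 m1.
Proof. by move=> e i; case: (e i). Qed.

Lemma congr_exponents_trans (N : nat) (m1 m2 m3 : {cmonom nat}) :
  congr_exponents N m1 m2 -> congr_exponents N m2 m3 -> congr_exponents N m1 m3.
Proof. by move=> e f i; case: (e i) (f i) => -> -> []. Qed.

Lemma congr_exponents_monomial (N : nat) (m1 m2 : {cmonom nat}) :
  congr_exponents N m1 m2 -> is_monomial m1 -> is_monomial m2.
Proof.
by move=> e /is_monomialP[i mi]; apply/is_monomialP; exists i; rewrite -(e i).1.
Qed.

Lemma congr_exponents_mI (N : nat) (m1 m2 : {cmonom nat}) :
  congr_exponents N m1 m2 -> mI m1 = mI m2.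
Proof.
move=> e; rewrite /mI; congr (\big[_/_]_(i <- _) _).
by congr enum_fset; apply/fsetP => i; rewrite -!cmE_neq0 (e i).1.
Qed.

Lemma congr_exponents_mdeg (N : nat) (m1 m2 : {cmonom nat}) :
  congr_exponents N m1 m2 -> mdeg m1 = mdeg m2 %[mod N].
Proof.
move=> e; rewrite (@mdeg_sum (mI m1) m1) // (@mdeg_sum (mI m1) m2).
  elim/big_ind2 : _ => // [a b c d|i _]; [exact: congr_modnD | exact: (e i).2].
by rewrite (congr_exponents_mI e).
Qed.

Lemma congr_exponents_expcmn (N a b : nat) (m1 m2 : {cmonom nat}) :
  (a == 0) = (b == 0) -> a = b %[mod N] -> congr_exponents N m1 m2 ->
  congr_exponents N (expcmn m1 a) (expcmn m2 b).
Proof.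
move=> z e f i; rewrite !expcmnE !muln_eq0 z (f i).1; split=> //.
exact: congr_modnM e (f i).2.
Qed.

(** * Monomial clones as substitution-closed sets of monomials *)

Lemma finField_primitive_root (F : finFieldType) :
  exists z : F, ((#|F| - 1).-primitive_root z)%R.
Proof.
pose rs := enum (predC1 (0 : F)%R).
have sz : size rs = #|F| - 1 by rewrite -cardE cardC1 subn1.
have F1 := finNzRing_gt1 F.
have /hasP[z _ zP] : has ((#|F| - 1).-primitive_root)%R rs.
  apply: has_prim_root; rewrite ?subn_gt0 ?sz ?enum_uniq //.
  apply/allP => x; rewrite mem_enum => x0.
  apply/unity_rootP/(mulfI x0).
  by rewrite mulr1 -exprS subn1 prednK ?expf_card // ltnW.
by exists z.
Qed.

Lemma expf_congr (F : finFieldType) (x : F) (a b : nat) :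
  (a == 0) = (b == 0) -> a = b %[mod #|F| - 1] -> (x ^+ a = x ^+ b)%R.
Proof.
move=> z ab; have [->|x0] := eqVneq x 0%R; first by rewrite !expr0n z.
have x1 : (x ^+ (#|F| - 1) = 1)%R.
  apply: (mulfI x0); rewrite mulr1 -exprS subn1 prednK ?expf_card //.
  by rewrite ltnW ?finNzRing_gt1.
rewrite (divn_eq a (#|F| - 1)) (divn_eq b (#|F| - 1)) !exprD.
by rewrite !(mulnC (_ %/ _)) !exprM x1 !expr1n ab.
Qed.

(** Setting all variables but one to 1 isolates the powers of that variable;
    its value at 0 shows whether the exponent vanishes, and its value at a
    primitive root gives the residue of the exponent. *)
Lemma induced_eqP (F : finFieldType) (n : nat) (m1 m2 : {cmonom nat}) :
  mI m1 <= n -> mI m2 <= n ->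
  induced F m1 n = induced F m2 n <-> congr_exponents (#|F| - 1) m1 m2.
Proof.
move=> /mI_leP m1n /mI_leP m2n; split=> [e i|e]; last first.
  apply/ffunP => x; rewrite !ffunE; apply: eq_bigr => i _.
  by apply: expf_congr; case: (e i).
have [ni|lt_in] := leqP n i; first by rewrite m1n // m2n.
pose a (x : F) : {ffun 'I_n -> F} :=
  [ffun j : 'I_n => if val j == i then x else 1%R].
have induced_a (m : {cmonom nat}) x : (induced F m n (a x) = x ^+ m i)%R.
  rewrite ffunE (bigD1 (Ordinal lt_in)) //= ffunE eqxx big1 ?mulr1 // => j ne.
  by rewrite ffunE ifN ?expr1n //.
have ei (x : F) : (x ^+ m1 i = x ^+ m2 i)%R by rewrite -!induced_a e.
split; last first.
  have [z zP] := finField_primitive_root F.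
  by apply/eqP; rewrite -(eq_prim_root_expr zP) ei.
have /eqP := ei 0%R; rewrite !expr0n.
by case: (m1 i == 0); case: (m2 i == 0);
  rewrite //= ?oner_eq0 // eq_sym oner_eq0.
Qed.

Lemma mkop_inj (A : finType) (n : nat) : injective (@mkop A n).
Proof. by move=> f g; exact: eq_from_Tagged. Qed.

Lemma equivalentP (F : finFieldType) (m1 m2 : {cmonom nat}) :
  equivalent F m1 m2 <-> congr_exponents (#|F| - 1) m1 m2.
Proof.
rewrite /equivalent; split=> e.
  have mI12 : mI m1 = mI m2 by exact: (congr1 (@tag _ _) e).
  move: e; rewrite mI12 => /mkop_inj.
  by move/induced_eqP; apply; rewrite ?mI12.
rewrite (congr_exponents_mI e); congr mkop.
by apply/induced_eqP; rewrite ?(congr_exponents_mI e).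
Qed.

(** Saturation of M under equivalence is what allows M to be recovered from its
    operations: the same operation may come from another monomial. *)
Lemma induced_opsP (F : finFieldType) (M : set {cmonom nat}) (n : nat)
    (m : {cmonom nat}) : monomial_clone F M -> mI m <= n ->
  induced_ops F M (mkop (induced F m n)) <-> M m.
Proof.
move=> [monM _ eqM] mn.
split=> [[m' [n' [Mm' m'n' e]]]|Mm]; last by exists m, n.
have en : n = n' by exact: (congr1 (@tag _ _) e).
move: m'n' e; rewrite -en => m'n /mkop_inj /induced_eqP e.
have {}e := congr_exponents_sym (e mn m'n).
apply: (eqM m') => //; last exact/equivalentP.
exact: congr_exponents_monomial e (monM _ Mm').
Qed.

Lemma proj_induced (F : finFieldType) (n : nat) (i : 'I_n) :
  proj F i = induced F (ucm (i : nat)) n.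
Proof.
apply/ffunP => x; rewrite !ffunE (bigD1 i) //= ucmE eqxx expr1.
rewrite big1 ?mulr1 // => j ne.
by rewrite ucmE eq_sym (inj_eq val_inj) (negPf ne) expr0.
Qed.

Lemma comp_induced (F : finFieldType) (n k : nat) (m : {cmonom nat})
    (g : 'I_n -> {cmonom nat}) :
  Defs.comp (induced F m n) (fun i => induced F (g i) k) =
  induced F (substm m g) k.
Proof.
apply/ffunP => x; rewrite !ffunE.
transitivity (\prod_(i < n) \prod_(j < k) x j ^+ (m i * g i j))%R.
  apply: eq_bigr => i _; rewrite !ffunE -prodrXl; apply: eq_bigr => j _.
  by rewrite -exprM mulnC.
rewrite exchange_big; apply: eq_bigr => j _; rewrite substmE.
by rewrite (big_morph _ (exprD (x j)) (expr0 (x j))).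
Qed.

Lemma mI_ucm (i : nat) : mI (ucm i) = i.+1.
Proof. by rewrite /mI mdomU big_seq_fset1. Qed.

Lemma mI_substm (n k : nat) (m : {cmonom nat}) (g : 'I_n -> {cmonom nat}) :
  (forall i, mI (g i) <= k) -> mI (substm m g) <= k.
Proof.
move=> gk; apply/mI_leP => j kj; rewrite substmE big1 // => i _.
by have /mI_leP -> := gk i; rewrite ?muln0.
Qed.

(** The purely combinatorial form of [monomial_clone], see [monomial_cloneP]:
    variables, substitution and saturation replace projections, composition and
    closure under [equivalent]. *)
Definition closed_monomials (N : nat) (M : set {cmonom nat}) : Prop :=
  [/\ forall m, M m -> is_monomial m,
      forall i, M (ucm i),
      forall n m (g : 'I_n -> {cmonom nat}), M m -> mI m <= n ->
        (forall i, M (g i)) -> M (substm m g)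
    & forall m1 m2, congr_exponents N m1 m2 -> M m1 -> M m2].

Lemma monomial_cloneP (F : finFieldType) (M : set {cmonom nat}) :
  monomial_clone F M <-> closed_monomials (#|F| - 1) M.
Proof.
split=> [MM|[monM projM subM eqM]].
  have [monM [_ projM compM] eqM] := MM; split=> //.
  - move=> i; have := projM i.+1 ord_max.
    by rewrite proj_induced induced_opsP // mI_ucm.
  - move=> n m g Mm mn Mg.
    pose k := \max_(i < n) mI (g i).
    have gk i : mI (g i) <= k by exact: leq_bigmax.
    apply/(induced_opsP MM (mI_substm m gk)); rewrite -comp_induced.
    by apply: compM => [|i]; apply/induced_opsP.
  - move=> m1 m2 e Mm1; apply: (eqM m1) => //; last exact/equivalentP.
    exact: congr_exponents_monomial e (monM _ Mm1).
split=> //; last by move=> m1 m2 _ /equivalentP; exact: eqM.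
split.
- move=> n f [m [n' [/monM/is_monomialP[i mi] mn e]]].
  have -> : n = n' by exact: (congr1 (@tag _ _) e).
  by case: n' mn {e} => // /mI_leP/(_ i isT) z; rewrite z in mi.
- by move=> n i; exists (ucm (i : nat)), n; rewrite mI_ucm proj_induced.
move=> k n f g [m [n' [Mm mn e]]] gM.
have en : n = n' by exact: (congr1 (@tag _ _) e).
move: mn e; rewrite -en => mn /mkop_inj ->.
have /choice[h hP] : forall i,
    exists m', [/\ M m', mI m' <= k & g i = induced F m' k].
  move=> i; have [m' [k' [Mm' m'k e]]] := gM i.
  have ek : k = k' by exact: (congr1 (@tag _ _) e).
  by move: m'k e; rewrite -ek => m'k /mkop_inj e; exists m'.
exists (substm m h), k; split.
- by apply: subM => // i; case: (hP i).
- by apply: mI_substm => i; case: (hP i).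
- rewrite -comp_induced; congr (mkop (Defs.comp _ _)).
  by apply: funext => i; case: (hP i).
Qed.

(** * Clones generated by one monomial, and closure properties *)

(** All closure conditions pass to intersections; the clone M is there to
    exclude the constant monomial, since an empty intersection would be the set
    of everything. *)
Lemma generated_clone (F : finFieldType) (G M : set {cmonom nat}) :
  monomial_clone F M -> G `<=` M -> monomial_clone F (generated F G).
Proof.
move=> MM GM; apply/monomial_cloneP; split.
- by move=> m Gm; have [monM _ _] := MM; exact: monM (Gm M (conj MM GM)).
- by move=> i A [/monomial_cloneP[_ +]].
- move=> n m g Gm mn Gg A AP; have [/monomial_cloneP[_ _ subA _] _] := AP.
  by apply: subA => // [|i]; [exact: Gm | exact: Gg].
- move=> m1 m2 e Gm A AP; have [/monomial_cloneP[_ _ _ eqA] _] := AP.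
  by apply: eqA e _; exact: Gm.
Qed.

Lemma generated_sub (F : finFieldType) (m : {cmonom nat})
    (M : set {cmonom nat}) :
  monomial_clone F M -> M m -> generated F [set m] `<=` M.
Proof. by move=> MM Mm; apply: smallest_sub => // x ->. Qed.

Lemma generated_gen (F : finFieldType) (m : {cmonom nat}) :
  generated F [set m] m.
Proof. exact: sub_gen_smallest. Qed.
Arguments generated_gen F m : clear implicits.

Lemma closed_expcmn (N a : nat) (M : set {cmonom nat}) (m : {cmonom nat}) :
  closed_monomials N M -> M (expcmn (ucm 0) a) -> M m -> M (expcmn m a).
Proof.
move=> [_ _ subM _] Ma Mm.
have -> : expcmn m a = substm (expcmn (ucm 0) a) (fun _ : 'I_1 => m).
  by apply: cm_ext => j; rewrite substmE big_ord1 !expcmnE ucmE eqxx muln1.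
apply: subM => //; apply/mI_leP => i i0; rewrite expcmnE ucmE.
by case: eqP i0 => [<-//|_ _]; rewrite muln0.
Qed.

Lemma closed_power (N a l : nat) (M : set {cmonom nat}) :
  closed_monomials N M -> M (expcmn (ucm 0) a) -> M (expcmn (ucm 0) (a ^ l)).
Proof.
move=> MM Ma; have [_ ucmM _ _] := MM.
elim: l => [|l IH]; first by rewrite expcmn1; exact: ucmM.
by rewrite expnSr -expcmn_mul; exact: closed_expcmn MM Ma IH.
Qed.

Definition binary (a b : nat) : {cmonom nat} :=
  mmul (expcmn (ucm 0) a) (expcmn (ucm 1) b).

Lemma binaryE (a b i : nat) : binary a b i = a * (0 == i) + b * (1 == i).
Proof. by rewrite mmulE !expcmnE !ucmE. Qed.

Lemma mdeg_binary (a b : nat) : mdeg (binary a b) = a + b.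
Proof. by rewrite mdegM !mdeg_expcmn !mdegU !muln1. Qed.

Lemma closed_binary (N a b : nat) (M : set {cmonom nat})
    (m1 m2 : {cmonom nat}) :
  closed_monomials N M -> M (binary a b) -> M m1 -> M m2 ->
  M (mmul (expcmn m1 a) (expcmn m2 b)).
Proof.
move=> [_ _ subM _] Mab M1 M2.
have -> : mmul (expcmn m1 a) (expcmn m2 b) =
    substm (binary a b) (fun i : 'I_2 => if val i == 0 then m1 else m2).
  apply: cm_ext => j; rewrite substmE big_ord_recl big_ord1 mmulE !expcmnE.
  by rewrite !binaryE /= !muln0 !muln1 addn0.
apply: subM => // [|i]; last by case: ifP.
by apply/mI_leP => i; rewrite binaryE; case: i => [|[|i]] //; rewrite !muln0.
Qed.

(** * Two upper bounds and the dichotomy *)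

(** Powers s ^ k rather than arbitrary exponents: substituting one variable
    power into another multiplies the exponents, so they run through the
    submonoid that s generates. *)
Definition power_clone (N s : nat) : set {cmonom nat} :=
  [set m | exists i k, congr_exponents N m (expcmn (ucm i) (s ^ k))].

(** For N > 1, degree 1 modulo N says by Fermat that the induced functions
    are idempotent, f (x, ..., x) = x. *)
Definition idempotent_clone (N : nat) : set {cmonom nat} :=
  [set m | mdeg m = 1 %[mod N]].

Lemma power_clone_closed (N s : nat) : 0 < s ->
  closed_monomials N (power_clone N s).
Proof.
move=> s0; split.
- move=> m [i [k /congr_exponents_sym e]]; apply: congr_exponents_monomial e _.
  apply/is_monomialP; exists i.
  by rewrite expcmnE ucmE eqxx muln1 -lt0n expn_gt0 s0.
- by move=> i; exists i, 0; rewrite expcmn1.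
- move=> n m g [i [k e]] mn gP.
  have lt_in : i < n.
    rewrite (leq_trans _ mn) // ltnNge; apply/negP => /mI_leP/(_ i (leqnn i)) z.
    have [+ _] := e i; rewrite z expcmnE ucmE !eqxx muln1 => /esym.
    by rewrite expn_eq0 gtn_eqF.
  have [j [l f]] := gP (Ordinal lt_in).
  exists j, (l + k); rewrite expnD -expcmn_mul.
  (* only x_i occurs in m, so that a single g i is substituted *)
  have -> : substm m g = expcmn (g (Ordinal lt_in)) (m i).
    apply: cm_ext => x; rewrite substmE (bigD1 (Ordinal lt_in)) //=.
    rewrite big1 ?addn0 ?expcmnE // => y ne.
    have [+ _] := e (y : nat); rewrite expcmnE ucmE.
    have -> : (i == y) = false by rewrite eq_sym; exact: negPf ne.
    by rewrite muln0 eqxx => /eqP ->.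
  have [z c] := e i; rewrite expcmnE ucmE eqxx muln1 in z c.
  exact: congr_exponents_expcmn.
- move=> m1 m2 /congr_exponents_sym e [i [k f]]; exists i, k.
  exact: congr_exponents_trans e f.
Qed.

Lemma idempotent_clone_closed (N : nat) : 1 < N ->
  closed_monomials N (idempotent_clone N).
Proof.
move=> N1; split.
- move=> m; rewrite /idempotent_clone /is_monomial /= => e; apply/eqP => m1.
  by move: e; rewrite m1 mdeg1 mod0n modn_small.
- by move=> i; rewrite /idempotent_clone /= mdegU.
- rewrite /idempotent_clone /= => n m g em mn eg.
  rewrite -em mdeg_substm (mdeg_sum mn).
  elim/big_ind2 : _ => // [a b c d|i _]; first exact: congr_modnD.
  by rewrite -[X in _ = X %% _]muln1; exact: congr_modnM.
- rewrite /idempotent_clone /= => m1 m2 e <-.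
  by rewrite (congr_exponents_mdeg e).
Qed.

(** With f = x ^ e y ^ c, where e is an idempotent power of a and e + c = 1, the
    term f (x, f (y, x)) is x ^ (e + c ^ 2) y ^ (c e); orthogonality of e and c
    turns the exponents into 1 and 0 modulo N, and the second one, being
    positive, is equivalent to N. *)
Lemma closed_absorption (N a b : nat) (M : set {cmonom nat}) : 0 < N ->
  closed_monomials N M -> M `<=` idempotent_clone N ->
  0 < a -> 0 < b -> M (binary a b) -> M (binary 1 N).
Proof.
move=> N0 MM idemM a0 b0 Mab; have [_ ucmM _ eqM] := MM.
(* substituting f into the first variable multiplies its exponent by a *)
have iter k : exists2 c, 0 < c & M (binary (a ^ k.+1) c).
  elim: k => [|k [c c0 Mc]]; first by exists b; rewrite ?expn1.
  exists (c * a + b); first by rewrite addn_gt0 b0 orbT.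
  have := closed_binary MM Mab Mc (ucmM 1).
  congr M; apply: cm_ext => i; rewrite mmulE !expcmnE !binaryE ucmE.
  by rewrite mulnDr mulnDl !mulnA -expnS (mulnC a c) addnA.
have [[//|l] _ ee] := exists_idempotent_power a N0.
have [c c0 Mec] := iter l; have ec := idemM _ Mec.
rewrite /idempotent_clone /= mdeg_binary in ec.
set e := a ^ l.+1 in ee Mec ec; have e0 : 0 < e by rewrite expn_gt0 a0.
have ec0 : e * c = 0 %[mod N].
  apply/eqP; rewrite -(eqn_modDl e) addn0.
  have := congr_modnM (erefl (e %% N)) ec.
  rewrite muln1 mulnDr => <-; apply/eqP; exact: congr_modnD.
have cc : c * c = c %[mod N].
  have := congr_modnM (erefl (c %% N)) ec.
  rewrite muln1 mulnDr => <-; rewrite -[c * c in LHS]add0n.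
  by apply: congr_modnD => //; rewrite mulnC ec0.
have Mce : M (mmul (expcmn (ucm 1) e) (expcmn (ucm 0) c)).
  exact: closed_binary MM Mec (ucmM 1) (ucmM 0).
have := closed_binary MM Mec (ucmM 0) Mce.
apply: eqM => -[|[|i]]; rewrite mmulE !expcmnE mmulE !expcmnE binaryE !ucmE /=;
  rewrite !muln0 ?muln1 ?add0n ?addn0 //.
- split; first by rewrite addn_eq0 gtn_eqF.
  by rewrite -ec; apply: congr_modnD.
- rewrite muln_eq0 !gtn_eqF //; split=> //.
  by rewrite modnn mulnC ec0 mod0n.
Qed.

(** Identifying all variables of a member m gives a power of one variable with
    exponent mdeg m.  If this is always trivial, a member outside
    [power_clone N 1] has two distinct variables, and identifying all but one of
    them gives a binary monomial to which [closed_absorption] applies. *)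
Lemma closed_dichotomy (N : nat) (M : set {cmonom nat}) : 0 < N ->
  closed_monomials N M -> ~ M `<=` power_clone N 1 ->
  (exists2 t, M (expcmn (ucm 0) t) & t <> 1 %[mod N]) \/ M (binary 1 N).
Proof.
move=> N0 MM nM; have [monM ucmM subM _] := MM.
have [idemM|] := pselect (M `<=` idempotent_clone N); last first.
  move/existsNP => [m /not_implyP[Mm nm]]; left; exists (mdeg m) => //.
  have := subM _ m (fun _ : 'I_(mI m) => ucm 0) Mm (leqnn _) (fun=> ucmM 0).
  congr M; apply: cm_ext => j.
  by rewrite substmE expcmnE ucmE -big_distrl /= -mdeg_sum.
right; move/existsNP: nM => [m /not_implyP[Mm nm]].
have /is_monomialP[i mi] := monM _ Mm.
have lt_in : i < mI m.
  by rewrite ltnNge; apply: contra mi => /mI_leP/(_ i (leqnn i)) ->.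
pose b := \sum_(k < mI m | k != Ordinal lt_in) m k.
have Mb : M (binary (m i) b).
  pose g (k : 'I_(mI m)) : {cmonom nat} :=
    if k == Ordinal lt_in then ucm 0 else ucm 1.
  have <- : substm m g = binary (m i) b.
    apply: cm_ext => j; rewrite substmE binaryE (bigD1 (Ordinal lt_in)) //=.
    rewrite /g eqxx ucmE.
    congr (_ + _); rewrite big_distrl; apply: eq_bigr => k /negPf ->.
    by rewrite ucmE.
  by apply: subM => // k; rewrite /g; case: ifP.
apply: (closed_absorption N0 MM idemM _ _ Mb); first by rewrite lt0n.
rewrite lt0n; apply/negP => b0; apply: nm; exists i, 0 => j.
rewrite expn0 expcmn1.
have [<-|ne] := eqVneq i j.
  rewrite ucmE eqxx; split; first exact: negPf.
  have := idemM _ Mm; rewrite /idempotent_clone /= (mdeg_sum (leqnn _)).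
  by rewrite (bigD1 (Ordinal lt_in)) //= -/b (eqP b0) addn0.
rewrite ucmE (negPf ne); suff -> : m j = 0 by [].
have [jn|nj] := ltnP j (mI m); last by have /mI_leP -> := leqnn (mI m).
move: b0; rewrite /b sum_nat_eq0 => /forallP/(_ (Ordinal jn))/implyP H.
by apply/eqP/H; apply: contra ne => /eqP [->].
Qed.

(** Equivalent monomials involve the same variables. *)
Lemma binary_notin_power_clone (N s a b : nat) : 0 < a -> 0 < b ->
  ~ power_clone N s (binary a b).
Proof.
move=> a0 b0 [i [k e]].
have := (e 0).1; have := (e 1).1.
rewrite !binaryE !expcmnE !ucmE /= !muln0 !muln1 addn0 add0n.
rewrite (gtn_eqF a0) (gtn_eqF b0).
by case: i {e} => [|[|i]]; rewrite /= ?muln0.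
Qed.

Lemma power_clone_mdeg (N s : nat) (m : {cmonom nat}) :
  power_clone N s m -> exists k, mdeg m = s ^ k %[mod N].
Proof.
move=> [i [k e]]; exists k.
by rewrite (congr_exponents_mdeg e) mdeg_expcmn mdegU muln1.
Qed.

Lemma unary_notin_projections (N t : nat) : t <> 1 %[mod N] ->
  ~ power_clone N 1 (expcmn (ucm 0) t).
Proof.
by move=> t1 /power_clone_mdeg[k]; rewrite mdeg_expcmn mdegU muln1 exp1n.
Qed.

(** * The atoms *)

Lemma generated_unary_sub (F : finFieldType) (s : nat) : 0 < s ->
  generated F [set expcmn (ucm 0) s] `<=` power_clone (#|F| - 1) s.
Proof.
move=> s0; apply: generated_sub; first exact/monomial_cloneP/power_clone_closed.
by exists 0, 1; rewrite expn1.
Qed.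

Lemma Delta_sub (F : finFieldType) : Delta F `<=` power_clone (#|F| - 1) 1.
Proof. by rewrite /Delta -(expcmn1 (ucm 0)); exact: generated_unary_sub. Qed.

Lemma neq_Delta (F : finFieldType) (M : set {cmonom nat}) (m : {cmonom nat}) :
  M m -> ~ power_clone (#|F| - 1) 1 m -> M <> Delta F.
Proof. by move=> Mm nm e; apply/nm/Delta_sub; rewrite -e. Qed.

(** Saturation puts all of [power_clone N 1] into every clone, so that it is
    the least one and [closed_dichotomy] applies to any other. *)
Lemma clone_cases (F : finFieldType) (M : set {cmonom nat}) :
  monomial_clone F M -> M <> Delta F ->
  (exists t, [/\ 0 < t, t <> 1 %[mod #|F| - 1] & M (expcmn (ucm 0) t)]) \/
  M (binary 1 (#|F| - 1)).
Proof.
move=> MM nM; have N0 : 0 < #|F| - 1 by rewrite subn_gt0 finNzRing_gt1.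
have MM' := (monomial_cloneP _ _).1 MM; have [monM ucmM _ eqM] := MM'.
have [MD|nMD] := pselect (M `<=` power_clone (#|F| - 1) 1); last first.
  have [[t Mt t1]|] := closed_dichotomy N0 MM' nMD; last by right.
  left; exists t; split=> //; rewrite lt0n; apply/eqP => t0.
  by move: (monM _ Mt); rewrite t0 /is_monomial eqxx.
case: nM; apply/seteqP; split; last exact: generated_sub.
move=> m /MD[i [k]]; rewrite exp1n expcmn1 => e A [AA _].
have [_ ucmA _ eqA] := (monomial_cloneP _ _).1 AA.
exact: eqA (congr_exponents_sym e) (ucmA i).
Qed.

(** By minimality an atom is generated by any of its nontrivial members, and
    [clone_cases] provides a suitable one; a power t is first replaced by a
    power of t that is idempotent or of prime order. *)
Lemma atom_generator (F : finFieldType) (C : set {cmonom nat}) : atom F C ->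
  C = generated F [set binary 1 (#|F| - 1)] \/
  exists s, [/\ 2 <= s <= #|F| - 1,
    (exists P, prime P /\ s ^ P = 1 %[mod #|F| - 1]) \/
      s * s = s %[mod #|F| - 1]
    & C = generated F [set expcmn (ucm 0) s]].
Proof.
case=> MC CD _ atomC; have N0 : 0 < #|F| - 1 by rewrite subn_gt0 finNzRing_gt1.
have atom_gen m : C m -> ~ power_clone (#|F| - 1) 1 m ->
    C = generated F [set m].
  move=> Cm nm; have sub := generated_sub MC Cm.
  have [||/esym//] := atomC (generated F [set m]) _ sub.
    by apply: (generated_clone MC) => x ->.
  by move/(neq_Delta (generated_gen F m) nm).
have [[t [t0 t1 Ct]]|CN] := clone_cases MC CD; last first.
  by left; apply: atom_gen => //; exact: binary_notin_power_clone.
have [l [tl1 tlP]] := exists_minimal_power N0 t1.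
have [r /andP[r0 rN] rtl] := exists_positive_residue (t ^ l) N0.
right; exists r; split.
- rewrite rN andbT ltn_neqAle r0 andbT; apply/eqP => r1.
  by apply: tl1; rewrite -rtl -r1.
- case: tlP => [[P [pP tP]]|tt]; [left; exists P; split=> //|right].
    by rewrite (congr_modnX P rtl).
  by rewrite (congr_modnM rtl rtl) tt rtl.
- apply: atom_gen; last by apply: unary_notin_projections; rewrite rtl.
  have MC' := (monomial_cloneP _ _).1 MC; have [_ _ _ eqC] := MC'.
  apply: eqC (closed_power l MC' Ct) => i.
  by apply: congr_exponents_expcmn; rewrite // ?rtl // !gtn_eqF // expn_gt0 t0.
Qed.

(** All members have degree 1 modulo N, which excludes x_1 x_2 (as N > 1) and
    nontrivial powers of a variable; so [clone_cases] finds the generator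
    x_1 x_2 ^ N in every nontrivial clone below. *)
Lemma atom_absorption (F : finFieldType) : 1 < #|F| - 1 ->
  atom F (generated F [set binary 1 (#|F| - 1)]).
Proof.
set N := #|F| - 1 => N1.
have MI := (monomial_cloneP F _).2 (idempotent_clone_closed N1).
have binI : idempotent_clone N (binary 1 N).
  by rewrite /idempotent_clone /= mdeg_binary modnDr.
have subI := generated_sub MI binI; have genN := generated_gen F (binary 1 N).
split.
- by apply: (generated_clone MI) => x ->.
- by apply: neq_Delta genN _; exact: binary_notin_power_clone (ltnW N1).
- move=> e; have : idempotent_clone N (binary 1 1).
    by apply: subI; rewrite e /binary !expcmn1; exact: generated_gen.
  rewrite /idempotent_clone /= mdeg_binary => /eqP.
  by rewrite -[X in _ == X %[mod _]]addn0 eqn_modDl mod0n modn_small.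
- move=> D MD DC; have [|nD] := pselect (D = Delta F); [by left | right].
  apply/seteqP; split=> //; have [[t [_ t1 Dt]]|DN] := clone_cases MD nD.
    have := subI _ (DC _ Dt).
    by rewrite /idempotent_clone /= mdeg_expcmn mdegU muln1.
  exact: generated_sub.
Qed.

(** All members are powers of single variables, so a nontrivial clone below
    contains some x_1 ^ t with t congruent to a power of s other than 1, and a
    power of t is congruent to s by [power_generates]. *)
Lemma atom_unary (F : finFieldType) (s : nat) : 2 <= s <= #|F| - 1 ->
  (exists P, prime P /\ s ^ P = 1 %[mod #|F| - 1]) \/
    s * s = s %[mod #|F| - 1] ->
  atom F (generated F [set expcmn (ucm 0) s]).
Proof.
set N := #|F| - 1 => /andP[s2 sN] sP.
have s0 : 0 < s := ltnW s2; have N1 : 1 < N := leq_trans s2 sN.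
have s1 : s <> 1 %[mod N].
  move=> e; move: sN; rewrite leq_eqVlt => /orP[/eqP sN|sN].
    by move: e; rewrite sN modnn modn_small.
  by move: e s2; rewrite !modn_small // => ->.
have subU := @generated_unary_sub F s s0.
have gens := generated_gen F (expcmn (ucm 0) s).
split.
- apply: (generated_clone ((monomial_cloneP F _).2 (power_clone_closed _ s0))).
  by move=> x ->; exact: subU.
- exact: neq_Delta gens (unary_notin_projections s1).
- move=> e; apply: (@binary_notin_power_clone N s 1 1) => //; apply: subU.
  by rewrite e /binary !expcmn1; exact: generated_gen.
- move=> D MD DC; have [|nD] := pselect (D = Delta F); [by left | right].
  apply/seteqP; split=> //.
  have [[t [t0 t1 Dt]]|DN] := clone_cases MD nD; last first.
    have /(binary_notin_power_clone (ltn0Sn 0) (ltnW N1)) := subU _ (DC _ DN).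
    by [].
  have [j] := power_clone_mdeg (subU _ (DC _ Dt)).
  rewrite mdeg_expcmn mdegU muln1 -/N => tj.
  have [l sl] : exists l, (s ^ j) ^ l = s %[mod N].
    by apply: power_generates sP; rewrite -tj.
  have MD' := (monomial_cloneP _ _).1 MD; have [_ _ _ eqD] := MD'.
  apply: generated_sub => //; apply: eqD (closed_power l MD' Dt) => i.
  apply: congr_exponents_expcmn => //; last by rewrite (congr_modnX l tj).
  by rewrite !gtn_eqF // expn_gt0 t0.
Qed.

Theorem corollary5p2 (q p k : nat) (hp : prime p) (hk : 0 < k)
    (hpk : q = p ^ k) (hq : 2 < q) (F : finFieldType) (hF : #|F| = q)
    (C : set {cmonom nat}) :
  atom F C <->
    C = generated F [set mmul (ucm 0) (expcmn (ucm 1) (q - 1))] \/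
    exists s : nat,
      [/\ 2 <= s <= q - 1,
          (exists P : nat, prime P /\ s ^ P = 1 %[mod q - 1]) \/
            s * s = s %[mod q - 1]
        & C = generated F [set expcmn (ucm 0) s]].
Proof.
have -> : mmul (ucm 0) (expcmn (ucm 1) (q - 1)) = binary 1 (q - 1).
  by rewrite /binary expcmn1.
rewrite -hF; split=> [|[->|[s [s2N sP ->]]]]; first exact: atom_generator.
  by apply: atom_absorption; rewrite hF ltn_subRL addn1.
exact: atom_unary.
Qed.
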